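(* Let $(K,d_K)$ be a compact metric space and let $(Y,d_Y)$ be a metric space. For each $k\in\mathbb{N}$ suppose that $T_k:K\to Y$ is a continuous operator, and assume that there is a continuous operator $T:K\to Y$ such that $\{T_k\}_{k=1}^{\infty}$ converges pointwise to $T$. If $d_Y(T_{k+1}(x),T(x))\leq d_Y(T_k(x),T(x))$ for all $k\in\mathbb{N}$ and all $x\in K$, then $\{T_k\}_{k=1}^{\infty}$ converges uniformly to $T$. *)

(* Defs.v *)
From mathcomp Require Export all_boot all_order all_algebra.
From mathcomp Require Export all_classical all_reals all_analysis.

(* Main.v *)
Require Import Defs.
From mathcomp Require Import all_boot all_order all_algebra.
From mathcomp Require Import all_classical all_reals all_analysis.
From mathcomp Require Import ring.

(** If [T_ N x] is close to [T x], then by continuity [T_ N y] is close to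
    [T y] for all [y] near [x], and by monotonicity so is [T_ n y] for all
    [n >= N].  Compactness then makes [N] independent of [x]. *)

Import Order.TTheory GRing.Theory Num.Theory.

Local Open Scope classical_set_scope.
Local Open Scope ring_scope.

(** The radius [e / 2] at [x] leaves a slack of [e / 2], shared equally by the two continuity
    estimates: the path from [f y] through [f x] and [g x] to [g y] has legs [e / 4], [e / 2] and
    [e / 4]. *)
Lemma near_ball_continuous (R : realType) (X : topologicalType)
    (Y : pseudoMetricType R) (f g : X -> Y) (e : R) (x : X) :
  0 < e -> {for x, continuous f} -> {for x, continuous g} ->
  ball (f x) (e / 2) (g x) -> \forall y \near x, ball (f y) e (g y).
Proof.
move=> e0 fx gx fgx; have e4 : 0 < e / 2 / 2 by rewrite !divr_gt0.
have /cvg_ballP/(_ _ e4) near_f := fx.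
have /cvg_ballP/(_ _ e4) near_g := gx.
near=> y; have -> : e = e / 2 / 2 + e / 2 + e / 2 / 2 by field.
apply: (@ball_triangle _ _ (g x)); last by near: y.
apply: (@ball_triangle _ _ (f x)) => //.
by apply: ball_sym; near: y.
Unshelve. all: by end_near. Qed.

Theorem proposition24 (R : realType) (K Y : metricType R)
    (Kcompact : compact [set: K])
    (T_ : nat -> K -> Y) (T : K -> Y)
    (Tk_continuous : forall k : nat, (1 <= k)%N -> continuous (T_ k))
    (T_limit_continuous : continuous T)
    (T_cvg_pointwise : forall x : K, T_ k x @[k --> \oo] --> T x)
    (T_dist_nonincreasing : forall k : nat, (1 <= k)%N -> forall x : K,
       mdist (T_ k.+1 x) (T x) <= mdist (T_ k x) (T x)) :
  {uniform, T_ @ \oo --> T}.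
Proof.
have mdist_le k n y : (1 <= k)%N -> (k <= n)%N ->
    mdist (T_ n y) (T y) <= mdist (T_ k y) (T y).
  move=> k1; elim: n => [|n IHn]; first by rewrite leqn0 => /eqP ->.
  rewrite leq_eqVlt => /predU1P[->//|]; rewrite ltnS => kn.
  apply: le_trans (IHn kn); apply: T_dist_nonincreasing.
  exact: leq_trans kn.
move=> P /uniform_nbhs[E [entE /filterS]]; apply.
move: entE; rewrite -entourage_ballE => -[e /= e0 eE].
suff : \forall n \near \oo, [set: K] `<=` [set y | ball (T y) e (T_ n y)].
  by apply: filterS => n Tn y _; apply: eE; exact: Tn.
(* In its near-covering form, compactness leaves a local task: for each [x], one neighbourhood of
   [x] and one rank that work jointly for all pairs [(y, n)]. *)
have /compact_near_coveringP := Kcompact; apply=> x _.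
have e2 : 0 < e / 2 by rewrite divr_gt0.
have /cvg_ballP/(_ _ e2) Tx := T_cvg_pointwise x.
(* [1 <= N] is required because continuity and monotonicity are assumed only from index 1 on. *)
have [N [N1 TN]] : exists N, (1 <= N)%N /\ ball (T x) (e / 2) (T_ N x).
  near \oo => N; exists N; split; near: N; [exact: nbhs_infty_ge|exact: Tx].
have TNx : \forall y \near x, ball (T y) e (T_ N y).
  exact: (near_ball_continuous _ _ _ _ _ _ _ e0 (T_limit_continuous x)
           (Tk_continuous N N1 x)).
exists ([set y | ball (T y) e (T_ N y)], [set n | (N <= n)%N]).
  by split => //; exact: nbhs_infty_ge.
(* Both balls are flipped so that the distances have [T y] as second argument, as in [mdist_le]. *)
move=> [y n] /= [/ball_sym + Nn]; rewrite ballEmdist/= => TNy.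
by apply: ball_sym; rewrite ballEmdist/=; apply: le_lt_trans TNy; exact: mdist_le.
Unshelve. all: by end_near. Qed.
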